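(* Let $L$ be a finite automorphic Moufang loop and let $\tau: L\to L$ be a half-automorphism of $L$. Then $\tau$ is an automorphism of $L$ (i.e. $\tau(xy)=\tau(x)\tau(y)$ for all $x,y\in L$) or $\tau$ is an anti-automorphism of $L$ (i.e. $\tau(xy)=\tau(y)\tau(x)$ for all $x,y\in L$).
   Context: A loop is a set $Q$ with a binary operation $\cdot$ and a two-sided neutral element $1$ such that for each $a\in Q$ the left multiplication $L_a:x\mapsto ax$ and the right multiplication $R_a:x\mapsto xa$ are bijections of $Q$. A Moufang loop is a loop satisfying the (equivalent) Moufang identities, e.g. $(xy)(zx)=(x(yz))x$ for all $x,y,z$. A loop $Q$ is automorphic if for all $x,y\in Q$ the inner mappings $\ell_{x,y}=L_{xy}^{-1}\circ L_x\circ L_y$, $r_{x,y}=R_{xy}^{-1}\circ R_y\circ R_x$ and $T_x=L_x^{-1}\circ R_x$ are automorphisms of $Q$. A half-automorphism of a loop $L$ is a bijection $\tau:L\to L$ such that for all $x,y\in L$ one has $\tau(xy)=\tau(x)\tau(y)$ or $\tau(xy)=\tau(y)\tau(x)$ (which alternative holds may depend on $x,y$). *)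

(* Defs.v *)
From HB Require Import structures.
From mathcomp Require Import all_boot.

Set Implicit Arguments.
Unset Strict Implicit.
Unset Printing Implicit Defensive.

Local Open Scope group_scope.

HB.mixin Record UMagma_isLoop Q of UMagma Q := {
  bij_mull : forall a : Q, bijective (fun x : Q => a * x);
  bij_mulr : forall a : Q, bijective (fun x : Q => x * a)
}.

#[short(type="loopType")]
HB.structure Definition Loop := {Q of UMagma_isLoop Q & UMagma Q}.

#[short(type="finLoopType")]
HB.structure Definition FinLoop := {Q of Loop Q & Finite Q}.

Section Loops.

Variable Q : loopType.

Definition ltrans (a x : Q) : Q := a * x.
Definition rtrans (a x : Q) : Q := x * a.

Definition moufang : Prop :=
  forall x y z : Q, (x * y) * (z * x) = (x * (y * z)) * x.

Definition automorphism (f : Q -> Q) : Prop :=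
  bijective f /\ forall x y, f (x * y) = f x * f y.

Definition anti_automorphism (f : Q -> Q) : Prop :=
  bijective f /\ forall x y, f (x * y) = f y * f x.

Definition half_automorphism (f : Q -> Q) : Prop :=
  bijective f /\
  forall x y, f (x * y) = f x * f y \/ f (x * y) = f y * f x.

End Loops.

(* For an injective self-map f of a finite type, [finv f] is the two-sided    *)
(* inverse of f (see [finv_f] and [f_finv]); translations are injective by    *)
(* [bij_mull] and [bij_mulr].                                                 *)
Section FiniteLoops.

Variable Q : finLoopType.

Definition linner (x y : Q) : Q -> Q :=
  finv (ltrans (x * y)) \o ltrans x \o ltrans y.

Definition rinner (x y : Q) : Q -> Q :=
  finv (rtrans (x * y)) \o rtrans y \o rtrans x.

Definition tinner (x : Q) : Q -> Q := finv (ltrans x) \o rtrans x.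

Definition automorphic : Prop :=
  forall x y : Q,
    [/\ automorphism (linner x y), automorphism (rinner x y)
      & automorphism (tinner x)].

End FiniteLoops.

Arguments moufang Q : clear implicits.
Arguments automorphic Q : clear implicits.

(* Main.v *)
(* For noncommuting a, b a half-automorphism f satisfies exactly one of       *)
(* f(ab) = f(a)f(b) and f(ab) = f(b)f(a); call (a, b) direct or reversed.     *)
(* Suppose (a, b) is direct and (a, c) reversed, and put x = f(a). Evaluating *)
(* f at (ab)(ca) = a(bc)a in two ways shows that f(b) commutes with f(c)x or  *)
(* f(c) commutes with f(b)x. The same holds after replacing b by ba^-1 or c   *)
(* by a^-1c. Since the T_x are automorphisms, centralizers are subloops, and  *)
(* these commutations force x to commute with f(b) or f(c), a contradiction.  *)
(* So each a has only one kind of noncommuting partner. If (p, q) is reversed *)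
(* and (r, s) direct, then p, q commute with r, s, so qr commutes with        *)
(* neither p nor s and has both kinds of partner, which is impossible.        *)

Require Import Defs.
From mathcomp Require Import all_boot.

Set Implicit Arguments.
Unset Strict Implicit.
Unset Printing Implicit Defensive.

Local Open Scope group_scope.

Lemma ltrans_inj (Q : loopType) (a : Q) : injective (ltrans a).
Proof. exact: bij_inj (bij_mull a). Qed.

Lemma rtrans_inj (Q : loopType) (a : Q) : injective (rtrans a).
Proof. exact: bij_inj (bij_mulr a). Qed.

Definition inv (Q : finLoopType) (x : Q) : Q := finv (ltrans x) 1.

(** * Moufang loops: inverses and Moufang identities *)

Section MoufangLoops.

Variables (Q : finLoopType) (Q_moufang : moufang Q).
Implicit Types a b p q w x y z : Q.

Lemma mulxV x : x * inv x = 1.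
Proof. exact: f_finv (ltrans_inj (a := x)) 1. Qed.

Lemma mulVx x : inv x * x = 1.
Proof.
apply: (ltrans_inj (a := x)); rewrite /ltrans mulg1.
by apply: (rtrans_inj (a := x)); rewrite /rtrans -Q_moufang mulxV mul1g.
Qed.

Lemma mulxVK x z : x * (inv x * z) = z.
Proof. by apply: (rtrans_inj (a := x)); rewrite /rtrans -Q_moufang mulxV mul1g. Qed.

Lemma invK x : inv (inv x) = x.
Proof. by apply: (ltrans_inj (a := inv x)); rewrite /ltrans mulxV mulVx. Qed.

Lemma mulVxK x z : inv x * (x * z) = z.
Proof. by rewrite -{2}[x]invK mulxVK. Qed.

Lemma flexible x z : (x * z) * x = x * (z * x).
Proof. by have := Q_moufang x 1 z; rewrite mulg1 mul1g. Qed.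

Lemma mulKVx y x : (y * inv x) * x = y.
Proof.
apply: (ltrans_inj (a := x)); rewrite /ltrans -flexible -Q_moufang.
by rewrite mulVx mulg1.
Qed.

Lemma mulKxV y x : (y * x) * inv x = y.
Proof. by rewrite -{1}[x]invK mulKVx. Qed.

Lemma invM x y : inv (x * y) = inv y * inv x.
Proof. by rewrite -[in inv x](mulKxV (inv x) (x * y)) mulVxK mulVxK. Qed.

(** Take y = (px)^-1 and z = (px)w in the Moufang identity: yz = w and xy = p^-1. *)
Lemma right_moufang p x w : ((p * x) * w) * x = p * (x * (w * x)).
Proof.
have := Q_moufang x (inv (p * x)) ((p * x) * w).
by rewrite mulVxK invM mulxVK flexible => <-; rewrite mulxVK.
Qed.

Lemma left_moufang x w p : x * (w * p) = (x * (w * x)) * (inv x * p).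
Proof.
have := Q_moufang x (w * p) (inv p); rewrite mulKxV flexible => <-.
by rewrite -[X in _ = _ * (_ * X)]invK -invM mulKxV.
Qed.

Lemma right_alternative p x : (p * x) * x = p * (x * x).
Proof. by have := right_moufang p x 1; rewrite mulg1 mul1g. Qed.

Lemma left_alternative x p : x * (x * p) = (x * x) * p.
Proof. by have := left_moufang x 1 (x * p); rewrite !mul1g mulVxK. Qed.

Section MiddleNuclear.

Variable k : Q.
Hypothesis k_mid : forall p q, p * (k * q) = (p * k) * q.

Lemma middle_nuclear_right p q : p * (q * k) = (p * q) * k.
Proof.
apply: (rtrans_inj (a := inv (q * k))); rewrite /rtrans mulKxV.
have := k_mid (p * q) (inv (q * k)).
by rewrite invM mulxVK mulKxV.
Qed.

End MiddleNuclear.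

(** * Automorphic Moufang loops: centralizers and commutators *)

Section Automorphic.

Hypothesis Q_automorphic : automorphic Q.

Lemma linner_def x y z : (x * y) * linner x y z = x * (y * z).
Proof. exact: f_finv (ltrans_inj (a := x * y)) _. Qed.

Lemma tinner_def x y : x * tinner x y = y * x.
Proof. exact: f_finv (ltrans_inj (a := x)) _. Qed.

Lemma linnerM x y p q : linner x y (p * q) = linner x y p * linner x y q.
Proof. by have [[_ ->]] := Q_automorphic x y. Qed.

Lemma tinnerM x p q : tinner x (p * q) = tinner x p * tinner x q.
Proof. by have [_ _ [_ ->]] := Q_automorphic x x. Qed.

(** Makes centralizers fixed-point sets of automorphisms, hence closed under products and
    cancellation. *)
Lemma commute_tinner x y : commute x y <-> tinner x y = y.
Proof.
split=> [cxy | fixy]; last by rewrite /commute -(tinner_def x) fixy.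
by apply: (ltrans_inj (a := x)); rewrite /ltrans tinner_def.
Qed.

Lemma commute_mul x p q : commute x p -> commute x q -> commute x (p * q).
Proof.
move=> /commute_tinner xp /commute_tinner xq.
by apply/commute_tinner; rewrite tinnerM xp xq.
Qed.

Lemma commute_mull x p q : commute x p -> commute x (p * q) -> commute x q.
Proof.
move=> /commute_tinner xp /commute_tinner xpq; apply/commute_tinner.
by move: xpq; rewrite tinnerM xp; apply: (@ltrans_inj _ p).
Qed.

Lemma commute_mulr x p q : commute x q -> commute x (p * q) -> commute x p.
Proof.
move=> /commute_tinner xq /commute_tinner xpq; apply/commute_tinner.
by move: xpq; rewrite tinnerM xq; apply: (@rtrans_inj _ q).
Qed.

(* In a Moufang loop the inner map l_{x,y} is a pseudo-automorphism whose     *)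
(* companion is a commutator, which must be nuclear once l_{x,y} is an        *)
(* automorphism.                                                              *)
Lemma commutator_middle_nuclear x y p q :
  let k := inv (x * y) * (y * x) in p * (k * q) = (p * k) * q.
Proof.
set s := x * y => k.
(* Expand l_{x,y}(PR) = l_{x,y}(P) l_{x,y}(R), where x(yP) = A and R = y(xD), by [left_moufang]:
   around s on one side, around y and then x on the other. *)
have transport A D :
    (A * s) * (inv s * linner x y (y * (x * D))) = (A * (y * x)) * D.
  have E : A = x * (y * (inv y * (inv x * A))) by rewrite !mulxVK.
  set P := inv y * _ in E; set R := y * (x * D).
  have := linner_def x y (P * R); rewrite linnerM left_moufang -flexible.
  rewrite linner_def -E -/s => ->.
  rewrite (left_moufang y) (left_moufang x) -(flexible y) -(flexible x) -Q_moufang -E.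
  by rewrite /R !mulVxK.
have kE D : k * D = inv s * linner x y (y * (x * D)).
  by rewrite /k -transport mulVx mul1g.
rewrite kE -{1}(mulKVx p s) transport; congr (_ * _).
by rewrite -[k]mulg1 kE -{2}(mulKVx p s) transport mulg1.
Qed.

(* T_v^-1 multiplies both x and u = xb on the right by the nuclear element    *)
(* k = T_x(v) v^-1, hence fixes u x^-1 = x b x^-1, where v = xc. So v         *)
(* commutes with x b x^-1; now apply T_x.                                     *)
Lemma commute_of_swap x b c :
  (x * c) * (x * b) = (x * b) * (c * x) -> commute b (c * x).
Proof.
set v := x * c; set u := x * b; set k := (c * x) * inv v => vu.
have kv : k * v = c * x by rewrite /k mulKVx.
(* k is the commutator of x^-1 and c^-1. *)
have k_mid p q : p * (k * q) = (p * k) * q.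
  have := commutator_middle_nuclear (inv x) (inv c) p q.
  by rewrite -!invM invM invK.
have tinner_mulk y : v * y = y * (c * x) -> tinner v (y * k) = y.
  move=> vy; apply: (ltrans_inj (a := v)); rewrite /ltrans tinner_def vy.
  by rewrite -k_mid kv.
have tx : tinner v (x * k) = x by apply: tinner_mulk; rewrite flexible.
have tu := tinner_mulk u vu.
pose t := u * inv x.
have utx : u = t * x by rewrite mulKVx.
have vt : commute v t.
  apply/commute_tinner; move: tu; rewrite {1}utx -(middle_nuclear_right k_mid).
  by rewrite tinnerM tx utx; apply: (@rtrans_inj _ x).
have tinner_t : tinner x t = b.
  by apply: (ltrans_inj (a := x)); rewrite /ltrans tinner_def -utx.
have tinner_v : tinner x v = c * x.
  by apply: (ltrans_inj (a := x)); rewrite /ltrans tinner_def flexible.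
by rewrite /commute -tinner_t -tinner_v -!tinnerM vt.
Qed.

End Automorphic.
End MoufangLoops.

(** * Half-automorphisms: direct and reversed pairs *)

Section HalfAutomorphisms.

Variables (Q : finLoopType) (f : Q -> Q).
Hypothesis f_half : half_automorphism f.
Implicit Types a b c d x y : Q.

Definition hom_pair a b := f (a * b) = f a * f b /\ f (b * a) = f b * f a.
Definition anti_pair a b := f (a * b) = f b * f a /\ f (b * a) = f a * f b.

Lemma hom_pair_sym a b : hom_pair a b -> hom_pair b a.
Proof. by case. Qed.

Lemma anti_pair_sym a b : anti_pair a b -> anti_pair b a.
Proof. by case. Qed.

Lemma half_inj : injective f.
Proof. by case: f_half => /bij_inj. Qed.

Lemma commute_half_inv x y : commute (f x) (f y) -> commute x y.
Proof.
rewrite /commute => fxy; apply: half_inj.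
by case: f_half => _ fM; case: (fM x y) => ->; case: (fM y x) => ->.
Qed.

(* (x, y) |-> (f x, f y) maps the finite set of noncommuting pairs            *)
(* injectively into itself, hence onto itself.                                *)
Lemma commute_half x y : commute x y -> commute (f x) (f y).
Proof.
pose S := [set p : Q * Q | p.1 * p.2 != p.2 * p.1].
pose g (p : Q * Q) := (f p.1, f p.2).
have g_inj : injective g.
  by move=> [u v] [u' v'] [/half_inj-> /half_inj->].
have gS : g @: S = S.
  apply/eqP; rewrite eqEcard card_imset // leqnn andbT.
  apply/subsetP=> _ /imsetP[p pS ->]; move: pS; rewrite !inE.
  by apply: contra => /eqP/commute_half_inv/eqP.
move=> xy; apply/eqP/negPn/negP => fxy.
have : g (x, y) \in g @: S by rewrite gS inE.
by rewrite mem_imset // inE /= xy eqxx.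
Qed.

Lemma hom_or_anti_pair a b : hom_pair a b \/ anti_pair a b.
Proof.
case: f_half => _ fM; have [ab | ab] := eqVneq (a * b) (b * a).
  have fab : commute (f a) (f b) by apply: commute_half.
  by left; split; [case: (fM a b) | case: (fM b a)] => ->.
have fN : f (a * b) <> f (b * a) by move/half_inj/eqP; rewrite (negPf ab).
case: (fM a b) => E1; case: (fM b a) => E2; rewrite E1 E2 in fN => //.
- by left.
- by right.
Qed.

Lemma hom_anti_pair_commute a b : hom_pair a b -> anti_pair a b -> commute a b.
Proof. by move=> [ab _] [_ ba]; apply: half_inj; rewrite ab ba. Qed.

Hypothesis Q_moufang : moufang Q.

Lemma half_square a : f (a * a) = f a * f a.
Proof. by case: f_half => _ fM; case: (fM a a). Qed.

(** Since a(ab) = a^2 b, its image is f(a)^2 f(b) or f(b) f(a)^2. Were (a, ab) reversed, it would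
    also be f(a)f(b)f(a), and cancelling f(a) would make f(a) and f(b) commute. *)
Lemma hom_pair_mull a b : ~ commute a b -> hom_pair a b -> hom_pair a (a * b).
Proof.
move=> ab_n [ab ba]; case: (hom_or_anti_pair a (a * b)) => // -[E _].
have fab_n : f a * f b <> f b * f a by move/commute_half_inv.
case: f_half => _ fM; move: E; rewrite (left_alternative Q_moufang) ab.
rewrite (flexible Q_moufang).
case: (fM (a * a) b) => ->; rewrite half_square.
  rewrite -(left_alternative Q_moufang) => /(@ltrans_inj _ (f a)).
  by move/fab_n.
rewrite -(right_alternative Q_moufang) -(flexible Q_moufang).
by move/(@rtrans_inj _ (f a))/esym/fab_n.
Qed.

Lemma anti_pair_mulr a b : ~ commute a b -> anti_pair a b -> anti_pair a (b * a).
Proof.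
move=> ab_n [ab ba]; case: (hom_or_anti_pair a (b * a)) => // -[_ E].
have fab_n : f a * f b <> f b * f a by move/commute_half_inv.
case: f_half => _ fM; move: E; rewrite (right_alternative Q_moufang) ba.
case: (fM b (a * a)) => ->; rewrite half_square.
  rewrite -(right_alternative Q_moufang) => /(@rtrans_inj _ (f a)).
  by move/esym/fab_n.
rewrite -(left_alternative Q_moufang) (flexible Q_moufang).
by move/(@ltrans_inj _ (f a))/fab_n.
Qed.

(** The word axa is a palindrome, so direct and reversed pairs give the same image. *)
Lemma half_sandwich a x : f ((a * x) * a) = (f a * f x) * f a.
Proof.
have [ax | /eqP ax] := eqVneq (a * x) (x * a).
  have fax : f a * f x = f x * f a by apply: commute_half.
  rewrite ax fax (right_alternative Q_moufang).
  case: f_half => _ fM; case: (fM x (a * a)) => ->; rewrite half_square.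
    by rewrite (right_alternative Q_moufang).
  by rewrite -(left_alternative Q_moufang) fax -(flexible Q_moufang) fax.
case: (hom_or_anti_pair a x) => H.
  by case: (hom_pair_mull ax H) => _ ->; case: H => ->.
rewrite (flexible Q_moufang).
by case: (anti_pair_mulr ax H) => -> _; case: H => _ ->.
Qed.

Hypothesis Q_automorphic : automorphic Q.

Lemma commute_divr a b : commute a (b * inv a) -> commute a b.
Proof.
move=> H; rewrite -(mulKVx Q_moufang b a).
exact: (commute_mul Q_automorphic).
Qed.

Lemma commute_divl a b : commute a (inv a * b) -> commute a b.
Proof.
move=> H; rewrite -(mulxVK Q_moufang a b).
exact: (commute_mul Q_automorphic).
Qed.

Lemma hom_pair_divr a b : ~ commute a b -> hom_pair a b ->
  hom_pair a (b * inv a) /\ f (b * inv a) = f b * inv (f a).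
Proof.
move=> ab_n ab; set d := b * inv a.
have bE : d * a = b by rewrite mulKVx.
have ad_n : ~ commute a d by move/commute_divr.
case: (hom_or_anti_pair a d) => H.
  by split=> //; case: H => _; rewrite bE => ->; rewrite mulKxV.
have := anti_pair_mulr ad_n H; rewrite bE.
by move/(hom_anti_pair_commute ab)/ab_n.
Qed.

Lemma anti_pair_divl a b : ~ commute a b -> anti_pair a b ->
  anti_pair a (inv a * b) /\ f (inv a * b) = f b * inv (f a).
Proof.
move=> ab_n ab; set d := inv a * b.
have bE : a * d = b by rewrite mulxVK.
have ad_n : ~ commute a d by move/commute_divl.
case: (hom_or_anti_pair a d) => H; last first.
  by split=> //; case: H; rewrite bE => -> _; rewrite mulKxV.
have := hom_pair_mull ad_n H; rewrite bE.
by move/hom_anti_pair_commute/(_ ab)/ab_n.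
Qed.

(* Compare the two evaluations of f on (ab)(ca) = (a(bc))a. *)
Lemma hom_anti_dichotomy a b c :
    ~ commute a b -> hom_pair a b -> ~ commute a c -> anti_pair a c ->
  commute (f b) (f c * f a) \/ commute (f c) (f b * f a).
Proof.
move=> ab_n [fab _] ac_n [_ fca].
have fab_n : f a * f b <> f b * f a by move/commute_half_inv.
have fac_n : f a * f c <> f c * f a by move/commute_half_inv.
case: f_half => _ fM; have := congr1 f (Q_moufang a b c).
rewrite half_sandwich.
(* If f treats (ab, ca) and (b, c) alike, cancellation contradicts noncommutation; otherwise
   [commute_of_swap] applies. *)
case: (fM (a * b) (c * a)) => ->; case: (fM b c) => ->;
  rewrite fab fca -Q_moufang.
- by move/(@ltrans_inj _ (f a * f b))/fac_n.
- by move/(commute_of_swap Q_moufang Q_automorphic); right.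
- by move/(commute_of_swap Q_moufang Q_automorphic); left.
- by move/(@ltrans_inj _ (f a * f c))/fab_n.
Qed.

(** If f(b) commutes with f(c)f(a), apply the dichotomy again to ba^-1, whose image is f(b)f(a)^-1;
    otherwise to a^-1c, whose image is f(c)f(a)^-1. The factor f(a) then cancels in a
    centralizer. *)
Lemma hom_anti_exclusive a b c :
  ~ commute a b -> hom_pair a b -> ~ commute a c -> anti_pair a c -> False.
Proof.
move=> ab_n ab ac_n ac.
have fab_n : ~ commute (f a) (f b) by move/commute_half_inv.
have fac_n : ~ commute (f a) (f c) by move/commute_half_inv.
have cM := commute_mul Q_automorphic.
have cMl := commute_mull Q_automorphic.
have cMr := commute_mulr Q_automorphic.
case: (hom_anti_dichotomy ab_n ab ac_n ac) => bc.
  have [ab' fab'] := hom_pair_divr ab_n ab.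
  have ab'_n : ~ commute a (b * inv a) by move/commute_divr.
  case: (hom_anti_dichotomy ab'_n ab' ac_n ac); rewrite fab' => bc'.
    apply/fac_n/(cMr _ _ (f a)) => //; apply/commute_sym.
    apply: (cMl _ (f b * inv (f a))); first exact/commute_sym.
    by rewrite mulKVx //; apply/commute_sym.
  rewrite mulKVx // in bc'.
  by apply/fab_n/commute_sym/(cMl _ (f c)) => //; apply/commute_sym.
have [ac' fac'] := anti_pair_divl ac_n ac.
have ac'_n : ~ commute a (inv a * c) by move/commute_divl.
case: (hom_anti_dichotomy ab_n ab ac'_n ac'); rewrite fac' => bc'.
  rewrite mulKVx // in bc'.
  by apply/fac_n/commute_sym/(cMl _ (f b)) => //; apply/commute_sym.
apply/fab_n/(cMr _ _ (f a)) => //; apply/commute_sym.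
apply: (cMl _ (f c * inv (f a))); first exact/commute_sym.
by rewrite mulKVx //; apply/commute_sym.
Qed.

(** Otherwise (p, r) is direct, giving p both kinds of partner, or reversed, giving r both. *)
Lemma anti_hom_commute p q r s :
    ~ commute p q -> anti_pair p q -> ~ commute r s -> hom_pair r s ->
  commute p r.
Proof.
move=> pq_n pq rs_n rs; have [// | /eqP pr_n] := eqVneq (p * r) (r * p).
case: (hom_or_anti_pair p r) => pr; exfalso.
  exact: hom_anti_exclusive pr_n pr pq_n pq.
apply: hom_anti_exclusive rs_n rs _ (anti_pair_sym pr).
by move/commute_sym.
Qed.

Lemma half_automorphism_trivial : automorphism f \/ anti_automorphism f.
Proof.
have [f_bij _] := f_half.
have [/forallP fH | ] := boolP [forall x, forall y, f (x * y) == f x * f y].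
  by left; split=> // x y; apply/eqP; move/forallP: (fH x); apply.
have [/forallP fA | ] := boolP [forall x, forall y, f (x * y) == f y * f x].
  by right; split=> // x y; apply/eqP; move/forallP: (fA x); apply.
case/forallPn=> r /forallPn[s /eqP rs_a]; case/forallPn=> p /forallPn[q /eqP pq_h].
exfalso.
have rs : hom_pair r s by case: (hom_or_anti_pair r s) => // -[].
have pq : anti_pair p q by case: (hom_or_anti_pair p q) => // -[].
have rs_n : ~ commute r s.
  by case: rs => E _ /commute_half fC; apply: rs_a; rewrite E fC.
have pq_n : ~ commute p q.
  by case: pq => E _ /commute_half fC; apply: pq_h; rewrite E fC.
have qp_n : ~ commute q p by move/commute_sym.
have sr_n : ~ commute s r by move/commute_sym.
have pr : commute p r := anti_hom_commute pq_n pq rs_n rs.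
have sq : commute s q.
  apply: commute_sym.
  exact: anti_hom_commute qp_n (anti_pair_sym pq) sr_n (hom_pair_sym rs).
have p_qr : ~ commute p (q * r) by move/(commute_mulr Q_automorphic pr).
have s_qr : ~ commute s (q * r) by move/(commute_mull Q_automorphic sq).
case: (hom_or_anti_pair p (q * r)) => [hp | ap].
  exact: hom_anti_exclusive p_qr hp pq_n pq.
case: (hom_or_anti_pair s (q * r)) => [hs | a_s]; last first.
  exact: hom_anti_exclusive sr_n (hom_pair_sym rs) s_qr a_s.

(* Here qr has the direct partner s and the reversed partner p. *)
have qr_p : ~ commute (q * r) p by move/commute_sym.
have qr_s : ~ commute (q * r) s by move/commute_sym.
exact: hom_anti_exclusive qr_s (hom_pair_sym hs) qr_p (anti_pair_sym ap).
Qed.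

End HalfAutomorphisms.

Theorem theorem3p1 (L : finLoopType) (tau : L -> L)
    (L_automorphic : automorphic L) (L_moufang : moufang L)
    (tau_half : half_automorphism tau) :
  automorphism tau \/ anti_automorphism tau.
Proof. exact: half_automorphism_trivial. Qed.
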